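(* Let $A\in\mathbb{R}_{\max}^{n\times n}$, and let $N_1,\dots,N_r$ be the node partition obtained from a maximal multi-circuit sequence of $A$ by the procedure described in the context, with quasi-critical circuits $\mathcal{C}_1,\dots,\mathcal{C}_r$ (where $\mathcal{C}_s$ is the quasi-critical circuit in $N_s$), indices $k(1),\dots,k(r)$, and lengths $\ell_s=\ell(\mathcal{C}_s)$. For $s=1,\dots,r$ let $S_s\in\{0,\varepsilon\}^{\ell_s\times\ell_s}$ be the matrix indexed by the nodes of $\mathcal{C}_s$ whose $(i,j)$ entry is $0$ if $(i,j)\in E(\mathcal{C}_s)$ and $\varepsilon$ otherwise. Then there exist matrices $C_s\in\mathbb{R}_{\max}^{n\times\ell_s}$ and $R_s\in\mathbb{R}_{\max}^{\ell_s\times n}$ ($s=1,\dots,r$), not depending on $t$, such that for all integers $t\ge 2n^2$, $$A^{\otimes t}=\bigoplus_{s=1}^{r}\lambda_{k(s)}^{\otimes t}\otimes C_s\otimes S_s^{\otimes t}\otimes R_s .$$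
   Context: Max-plus algebra: $\mathbb{R}_{\max}=\mathbb{R}\cup\{\varepsilon\}$, $\varepsilon=-\infty$, $a\oplus b=\max(a,b)$, $a\otimes b=a+b$; matrix operations and powers are defined as usual with these operations. An empty max-plus sum is the matrix with all entries $\varepsilon$. Graph: for $A=(a_{ij})\in\mathbb{R}_{\max}^{n\times n}$, $\mathcal{G}(A)$ is the weighted digraph with node set $N=\{1,\dots,n\}$, arcs $(i,j)$ whenever $a_{ij}\ne\varepsilon$, with weight $a_{ij}$. Paths are node sequences following arcs (nodes may repeat); length $\ell(\cdot)$ is the number of arcs, weight $w(\cdot)$ the sum of arc weights. A circuit is a closed path; it is elementary if no node is repeated apart from the coinciding start and end. $N(\mathcal{C})$, $E(\mathcal{C})$ are the node and arc sets of $\mathcal{C}$. A multi-circuit is a (possibly empty) set of pairwise node-disjoint elementary circuits; its length and weight are the sums of those of its circuits (both $0$ for the empty one). Characteristic polynomial: $\chi_A(t)=\det(A\oplus t\otimes I_n)$, where $\det B=\max_{\pi\in S_n}\sum_i b_{i\pi(i)}$ and $I_n$ has $0$ on the diagonal and $\varepsilon$ elsewhere. Its roots are the $r_i$ in its factorization into max-plus linear factors $t\oplus r_i$. Let $\lambda_1>\lambda_2>\dots>\lambda_p$ be its distinct finite roots, $\lambda_0=+\infty$, $\lambda_{p+1}=\varepsilon=-\infty$. For $\lambda\in\mathbb{R}$, a multi-circuit $\mathfrak{C}$ is a $\lambda$-maximal multi-circuit ($\lambda$-MMC) if $\chi_A(\lambda)=w(\mathfrak{C})+\lambda(n-\ell(\mathfrak{C}))$.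 A maximal multi-circuit sequence (MMCS) of $A$ is a sequence $\mathfrak{C}_0=\emptyset,\mathfrak{C}_1,\dots,\mathfrak{C}_p$ of multi-circuits such that for each $k=0,\dots,p$, $\mathfrak{C}_k$ is a $\lambda$-MMC for all real $\lambda$ with $\lambda_{k+1}\le\lambda\le\lambda_k$. Node partition procedure: start with $r=0$, $N_0=U_0=\emptyset$. For $k=1,\dots,p$, and for each circuit $\mathcal{C}\in\mathfrak{C}_k$ (in some order): if $N(\mathcal{C})\cap U_r\ne\emptyset$, replace $N_r$ by $N_r\cup(N(\mathcal{C})\setminus U_r)$ and $U_r$ by $U_r\cup N(\mathcal{C})$; otherwise set $N_{r+1}=N(\mathcal{C})$, $U_{r+1}=U_r\cup N(\mathcal{C})$ and increase $r$ by one. At the end add all nodes of $N\setminus U_r$ to $N_r$ and set $U_r=N$. The output is $N_1,\dots,N_r$. The circuit $\mathcal{C}$ that initially created $N_s$ is called the quasi-critical circuit in $N_s$, and $k(s)$ is the index $k$ of the multi-circuit $\mathfrak{C}_k$ from which it was taken when $N_s$ was created. *)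

(* Defs.v *)
From HB Require Import structures.
From mathcomp Require Import all_boot all_order all_algebra.
From mathcomp Require Import perm constructive_ereal reals.

Set Implicit Arguments.
Unset Strict Implicit.
Unset Printing Implicit Defensive.

Import Order.TTheory GRing.Theory Num.Theory.
Local Open Scope ring_scope.

(** R_max = R with -oo adjoined, as a commutative semiring: [None] is epsilon,
    [+] is max and [*] is the addition of reals.  Hence in [ring_scope], at type
    [rmax R]: [0] is epsilon, [1] is the real number 0, [\sum] is a maximum,
    [\prod] is a sum of reals, [x ^+ k] is k times x; and [+], [*m], [^+], [*:]
    and [1%:M] on matrices over [rmax R] are the max-plus operations. *)
Definition rmax (R : realType) : Type := option R.

HB.instance Definition _ (R : realType) := Choice.on (rmax R).

Section MaxPlus.
Variable R : realType.
Implicit Types a b c : rmax R.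

Definition fin_rmax (x : R) : rmax R := Some x.

Definition mp_add a b : rmax R :=
  match a, b with
  | Some x, Some y => Some (Num.max x y)
  | None, _ => b
  | _, None => a
  end.

Definition mp_mul a b : rmax R :=
  match a, b with
  | Some x, Some y => Some (x + y)
  | _, _ => None
  end.

Lemma mp_addA : associative mp_add.
Proof. by case=> [x|] [y|] [z|] //=; rewrite maxA. Qed.

Lemma mp_addC : commutative mp_add.
Proof. by case=> [x|] [y|] //=; rewrite maxC. Qed.

Lemma mp_add0 : left_id (None : rmax R) mp_add.
Proof. by case. Qed.

HB.instance Definition _ :=
  GRing.isNmodule.Build (rmax R) mp_addA mp_addC mp_add0.

Lemma mp_mulA : associative mp_mul.
Proof. by case=> [x|] [y|] [z|] //=; rewrite addrA. Qed.

Lemma mp_mulC : commutative mp_mul.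
Proof. by case=> [x|] [y|] //=; rewrite addrC. Qed.

Lemma mp_mul1 : left_id (fin_rmax 0) mp_mul.
Proof. by case=> [x|] //=; rewrite add0r. Qed.

Lemma mp_mulDl : left_distributive mp_mul +%R.
Proof. by case=> [x|] [y|] [z|] //; congr Some; apply: addr_maxl. Qed.

Lemma mp_mul0 : left_zero 0 mp_mul.
Proof. by []. Qed.

Lemma mp_oner_neq0 : fin_rmax 0 != 0.
Proof. by []. Qed.

HB.instance Definition _ :=
  GRing.Nmodule_isComNzSemiRing.Build (rmax R)
    mp_mulA mp_mulC mp_mul1 mp_mulDl mp_mul0 mp_oner_neq0.

Lemma fin_rmaxD (x y : R) : fin_rmax x + fin_rmax y = fin_rmax (Num.max x y).
Proof. by []. Qed.

Lemma fin_rmaxM (x y : R) : fin_rmax x * fin_rmax y = fin_rmax (x + y).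
Proof. by []. Qed.

Lemma fin_rmaxX (x : R) k : fin_rmax x ^+ k = fin_rmax (x *+ k).
Proof. by elim: k => // k IH; rewrite exprS IH fin_rmaxM mulrS. Qed.

End MaxPlus.

Notation "x %:mp" := (fin_rmax x) (at level 1,
  format "x %:mp") : ring_scope.

Section CharacteristicPolynomial.
Variables (R : realType) (n : nat).
Implicit Types A B : 'M[rmax R]_n.

Definition mp_det B : rmax R := \sum_(pi : 'S_n) \prod_(i < n) B i (pi i).

Definition mp_char A (t : rmax R) : rmax R := mp_det (A + t%:M).

(** The factorization is one of functions of [t]: max-plus polynomials do not
    factor formally.  It has n factors and no constant, since the leading
    coefficient of [mp_char A] is the max-plus unit. *)
Definition mp_char_roots A (rs : n.-tuple (rmax R)) : Prop :=
  forall t : rmax R, mp_char A t = \prod_(i < n) (t + tnth rs i).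

Definition distinct_finite_roots A (lam : seq R) : Prop :=
  sorted >%R lam /\
  exists2 rs : n.-tuple (rmax R),
    mp_char_roots A rs & forall x : R, (x \in lam) = (x%:mp \in rs).

(** lambda_0 = +oo, lambda_1, ..., lambda_p, lambda_{p+1} = -oo, where
    [lam = [:: lambda_1; ...; lambda_p]]. *)
Definition root_at (lam : seq R) (k : nat) : \bar R :=
  nth -oo%E (+oo%E :: [seq x%:E | x <- lam]) k.

End CharacteristicPolynomial.

Section Circuits.
Variables (R : realType) (n : nat).
Implicit Types (A : 'M[rmax R]_n) (lam : seq R).

Definition arc A : rel 'I_n := fun i j => A i j != 0.

(** The closed path (i_1, ..., i_l, i_1) is the sequence [:: i_1; ...; i_l]. *)
Definition circuit := seq 'I_n.

Definition circuit_arcs (c : circuit) : seq ('I_n * 'I_n) := zip c (rot 1 c).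

Definition elementary_circuit A (c : circuit) : bool :=
  [&& c != [::], uniq c & cycle (arc A) c].

Definition circuit_weight A (c : circuit) : rmax R :=
  \prod_(e <- circuit_arcs c) A e.1 e.2.

(** A set of circuits is listed in an arbitrary order, which is also the order
    in which the node partition procedure goes through it. *)
Definition multicircuit := seq circuit.

Definition is_multicircuit A (cc : multicircuit) : bool :=
  all (elementary_circuit A) cc &&
  pairwise (fun c d : circuit => [disjoint c & d]) cc.

Definition mc_length (cc : multicircuit) : nat := \sum_(c <- cc) size c.

Definition mc_weight A (cc : multicircuit) : rmax R :=
  \prod_(c <- cc) circuit_weight A c.

(** The subtraction does not truncate: the circuits of [cc] are elementary and
    pairwise disjoint. *)
Definition is_MMC A (x : R) (cc : multicircuit) : Prop :=
  is_multicircuit A cc /\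
  mp_char A x%:mp = mc_weight A cc * x%:mp ^+ (n - mc_length cc).

Definition is_MMCS A lam (ccs : seq multicircuit) : Prop :=
  [/\ size ccs = (size lam).+1,
      nth [::] ccs 0 = [::] &
      forall k : nat, (k <= size lam)%N ->
        is_multicircuit A (nth [::] ccs k) /\
        forall x : R, (root_at lam k.+1 <= x%:E <= root_at lam k)%E ->
          is_MMC A x (nth [::] ccs k)].

End Circuits.

Section NodePartition.
Variable n : nat.

Record block := Block {
  block_nodes : {set 'I_n};      (* N_s *)
  block_circuit : circuit n;     (* the quasi-critical circuit C_s *)
  block_index : nat              (* k(s) *)
}.

Definition add_nodes (V : {set 'I_n}) (b : block) : block :=
  Block (block_nodes b :|: V) (block_circuit b) (block_index b).

(** A state is (U_r, [:: N_r; ...; N_1]), the latest block coming first.  When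
    r = 0 nothing is recorded: N_0 is not part of the output. *)
Definition add_to_last (V : {set 'I_n}) (bs : seq block) : seq block :=
  if bs is b :: bs' then add_nodes V b :: bs' else [::].

Definition partition_step (st : {set 'I_n} * seq block)
    (kc : nat * circuit n) : {set 'I_n} * seq block :=
  let: (U, bs) := st in
  let: (k, c) := kc in
  let Nc := [set i in c] in
  (U :|: Nc,
   if Nc :&: U != set0 then add_to_last (Nc :\: U) bs else Block Nc c k :: bs).

(** The circuits of C_1, ..., C_p in turn, each paired with its index k. *)
Definition indexed_circuits (ccs : seq (multicircuit n)) :
    seq (nat * circuit n) :=
  [seq (k, c) | k <- iota 1 (size ccs).-1, c <- nth [::] ccs k].

Definition node_partition (ccs : seq (multicircuit n)) : seq block :=
  let: (U, bs) := foldl partition_step (set0, [::]) (indexed_circuits ccs) in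
  rev (add_to_last (~: U) bs).

End NodePartition.

(** The nodes of [c] are indexed by their positions in [c]. *)
Definition circuit_mx (R : realType) (n : nat) (c : circuit n) :
    'M[rmax R]_(size c) :=
  \matrix_(i, j)
    if (tnth (in_tuple c) i, tnth (in_tuple c) j) \in circuit_arcs c
    then 1 else 0.

(* Main.v *)
Require Import Defs.
From mathcomp Require Import all_boot all_order all_algebra.
From mathcomp Require Import perm constructive_ereal reals zify ring lra.

Set Implicit Arguments.
Unset Strict Implicit.
Unset Printing Implicit Defensive.

Import Order.TTheory GRing.Theory Num.Theory.
Local Open Scope ring_scope.

(** The entry (i, j) of the t-th power of A is the largest weight of a walk of
    length t from i to j, so the statement compares such walks with the terms of
    the right-hand side.  List the circuits of the multi-circuits
    C_1, ..., C_p in the order of the node partition procedure.  The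
    quasi-critical circuits are the circuits of this list that are disjoint
    from all their predecessors (mem_node_partition).

    Optimality of the multi-circuits gives two estimates.  As C_k is optimal at
    lambda_k, deleting one of its circuits cannot improve it, hence each of its
    circuits has mean at least lambda_k (circuit_ge_in_MMC).  As C_(k-1) is
    optimal at lambda_k too, adding a circuit disjoint from it cannot improve
    it, hence a closed walk avoiding C_(k-1) has mean at most lambda_k
    (circuit_le_off_MMC, closed_walk_outside_le).  The same argument at
    lambda -> -oo shows that a walk of length at least n meets C_p (walk_hits).

    Take now a walk W of length t >= 2 n^2 and let c, from C_k, be the first
    circuit of the list that W meets.  If c meets an earlier circuit of the
    list, split W at a node of c.  One of the two parts has at least n l arcs,
    where l is the length of c, and the pigeonhole principle on pairs (node,
    position modulo l) yields in it a closed subwalk of length m l, with m > 0.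
    Exchanging that subwalk for m turns around c keeps the length and does not
    lower the weight, because W avoids C_(k-1).  The new walk contains all nodes
    of c, hence meets an earlier circuit of the list.  Repeating this, one is
    left with walks whose first circuit c is disjoint from all earlier ones,
    i.e. is quasi-critical (walk_to_fresh_circuit).

    For a quasi-critical circuit c, the matrices csr_left and csr_right collect
    the walks to and from a base node of c that avoid all earlier circuits and
    have length less than n l, normalised by lambda_k and sorted by their
    length modulo l.  Adding turns around c, any such pair of walks is completed
    to a walk of length t (csr_le); conversely, removing closed subwalks whose
    length is a multiple of l reduces any walk that meets c and avoids the
    earlier circuits to such a pair (csr_ge). *)

(** * The order of the max-plus semiring *)

Definition mp_le (R : realType) (a b : rmax R) : Prop := a + b = b.

Notation "a '<=mp' b" := (mp_le a b) (at level 70, no associativity).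

Section MaxPlusOrder.
Variable R : realType.
Implicit Types a b c d : rmax R.

Lemma mp_le_refl a : a <=mp a.
Proof. by case: a => // x; congr Some; apply: maxxx. Qed.

Lemma mp_le_trans b a c : a <=mp b -> b <=mp c -> a <=mp c.
Proof. by rewrite /mp_le => ab bc; rewrite -bc addrA ab. Qed.

Lemma mp_le_antisym a b : a <=mp b -> b <=mp a -> a = b.
Proof. by rewrite /mp_le => ab ba; rewrite -ab addrC ba. Qed.

Lemma mp_le0 a : 0 <=mp a.
Proof. by []. Qed.

Lemma mp_le_addr a b : a <=mp a + b.
Proof. by rewrite /mp_le addrA; congr (_ + _); apply: mp_le_refl. Qed.

Lemma mp_le_fin (x y : R) : x%:mp <=mp y%:mp <-> x <= y.
Proof.
rewrite /mp_le fin_rmaxD; split=> [[<-]|xy]; first by rewrite le_max lexx.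
by rewrite max_r.
Qed.

Lemma mp_le_add a b c : a <=mp c -> b <=mp c -> a + b <=mp c.
Proof. by rewrite /mp_le => ac bc; rewrite -addrA bc. Qed.

Lemma mp_le_mul a b c d : a <=mp b -> c <=mp d -> a * c <=mp b * d.
Proof.
move=> ab cd; apply: (@mp_le_trans (b * c)).
  by rewrite /mp_le -mulrDl ab.
by rewrite /mp_le -mulrDr cd.
Qed.

Lemma mp_neq0P a : reflect (exists x : R, a = x%:mp) (a != 0).
Proof.
case: a => [x|]; first by apply: ReflectT; exists x.
by apply: ReflectF => -[].
Qed.

Lemma mp_mul_eq0 a b : (a * b == 0) = (a == 0) || (b == 0).
Proof. by case: a => [x|]; case: b => [y|]. Qed.

Lemma mp_mulVr (x : R) m : x%:mp ^+ m * (- x)%:mp ^+ m = 1.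
Proof. by rewrite -exprMn fin_rmaxM subrr expr1n. Qed.

Lemma mp_le_cancel c a b : c != 0 -> c * a <=mp c * b -> a <=mp b.
Proof.
case/mp_neq0P=> x -> le.
have := mp_le_mul (mp_le_refl (- x)%:mp) le.
by rewrite !mulrA fin_rmaxM addNr !mul1r.
Qed.

Lemma mp_sum_le (I : Type) (r : seq I) (P : pred I) (F : I -> rmax R) b :
  (forall i, P i -> F i <=mp b) -> \sum_(i <- r | P i) F i <=mp b.
Proof.
move=> Fb; elim/big_ind: _ => // x y; exact: mp_le_add.
Qed.

Lemma mp_le_sum (I : finType) (P : pred I) (F : I -> rmax R) i :
  P i -> F i <=mp \sum_(i | P i) F i.
Proof. by move=> Pi; rewrite (bigD1 i) //=; apply: mp_le_addr. Qed.

Lemma mp_le_prod (I : Type) (r : seq I) (P : pred I) (F G : I -> rmax R) :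
  (forall i, P i -> F i <=mp G i) ->
  \prod_(i <- r | P i) F i <=mp \prod_(i <- r | P i) G i.
Proof.
move=> FG; elim/big_ind2: _ => //; first exact: mp_le_refl.
by move=> *; apply: mp_le_mul.
Qed.

Lemma mp_prod_neq0 (I : eqType) (r : seq I) (F : I -> rmax R) :
  (forall i, i \in r -> F i != 0) -> \prod_(i <- r) F i != 0.
Proof.
move=> F0; rewrite big_seq; elim/big_ind: _ => //.
by move=> x y x0 y0; rewrite mp_mul_eq0 negb_or x0.
Qed.

End MaxPlusOrder.

(** * Multi-circuits and the characteristic polynomial *)

Section Circuits.
Variables (R : realType) (n : nat) (A : 'M[rmax R]_n).
Implicit Types (c d : circuit n) (cc : multicircuit n) (x : R).

Lemma circuit_arcsE c : uniq c -> circuit_arcs c = [seq (i, next c i) | i <- c].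
Proof.
rewrite /circuit_arcs; case: c => // y c' Uc; set c := y :: c' in Uc *.
have szr : size (rot 1 c) = size c by rewrite size_rot.
apply: (@eq_from_nth _ (y, y)) => [|i]; first by rewrite size_zip szr minnn size_map.
rewrite size_zip szr minnn => ltic.
rewrite nth_zip // (nth_map y) //; congr (_, _).
by rewrite next_nth mem_nth // index_uniq // rot1_cons nth_rcons_default.
Qed.

Lemma circuit_weightE c :
  uniq c -> circuit_weight A c = \prod_(i <- c) A i (next c i).
Proof. by move=> Uc; rewrite /circuit_weight circuit_arcsE // big_map. Qed.

Lemma circuit_weight_rot c m :
  uniq c -> circuit_weight A (rot m c) = circuit_weight A c.
Proof.
move=> Uc; rewrite !circuit_weightE ?rot_uniq //.
rewrite (perm_big c) /=; last by rewrite perm_rot.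
by apply: eq_bigr => i _; rewrite next_rot.
Qed.

Lemma circuit_weight_neq0 c : elementary_circuit A c -> circuit_weight A c != 0.
Proof.
case/and3P=> _ Uc cyc; rewrite circuit_weightE //; apply: mp_prod_neq0 => i.
exact: (next_cycle cyc).
Qed.

(** The circuits being disjoint, the order of composition is irrelevant, and as a
    composition of bijections the map is injective without any case analysis. *)
Definition mc_succ cc (i : 'I_n) : 'I_n := foldr (fun c j => next c j) i cc.

Lemma mc_succ_inj cc : all uniq cc -> injective (mc_succ cc).
Proof.
elim: cc => [|c cc IH] /=; first by move=> _ i j.
case/andP=> Uc /IH inj i j /= /(congr1 (prev c)).
by rewrite !prev_next //; apply: inj.
Qed.

Lemma next_notin (T : eqType) (c : seq T) i : i \notin c -> next c i = i.
Proof. by move=> ic; rewrite next_nth (negPf ic). Qed.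

Lemma mc_succ_out cc i : i \notin flatten cc -> mc_succ cc i = i.
Proof.
elim: cc => //= c cc IH; rewrite mem_cat negb_or => /andP[ic icc].
by rewrite IH // next_notin.
Qed.

Lemma disjoint_flatten c cc :
  all (fun d => [disjoint c & d]) cc -> {in c, forall i, i \notin flatten cc}.
Proof.
move=> /allP dis i ic; apply/negP=> /flattenP[d dcc id].
by have /(disjointFr (dis d dcc)) := ic; rewrite id.
Qed.

Lemma mc_succ_in cc c i :
  pairwise (fun c d : circuit n => [disjoint c & d]) cc ->
  c \in cc -> i \in c -> mc_succ cc i = next c i.
Proof.
elim: cc => //= d cc IH /andP[dis pw]; rewrite inE => /orP[/eqP -> id|ccc ic].
  by rewrite mc_succ_out //; apply: (disjoint_flatten dis id).
rewrite IH // next_notin //.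
rewrite -mem_next in ic.
by have /allP/(_ c ccc)/disjointFl-> := dis.
Qed.

Lemma mc_length_flatten cc : mc_length cc = size (flatten cc).
Proof. by rewrite size_flatten sumnE big_map. Qed.

Lemma multicircuit_uniq cc : is_multicircuit A cc -> all uniq cc.
Proof. by case/andP=> /allP el _; apply/allP => c /el /and3P[]. Qed.

Lemma flatten_uniq cc : is_multicircuit A cc -> uniq (flatten cc).
Proof.
elim: cc => //= c cc IH /andP[/= /andP[/and3P[_ Uc _] el] /andP[dis pw]].
rewrite cat_uniq Uc IH ?/is_multicircuit ?el ?pw // andbT.
by apply/hasPn => i icc; apply: contraL icc; apply: disjoint_flatten.
Qed.

(** A multi-circuit, completed by loops of weight x at the nodes off it, is a
    permutation, hence one of the terms of the determinant. *)
Lemma mc_weight_le_char x cc :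
  is_multicircuit A cc ->
  mc_weight A cc * x%:mp ^+ (n - mc_length cc) <=mp mp_char A x%:mp.
Proof.
move=> mc; have [/allP el pw] := andP mc.
have Ucc := multicircuit_uniq mc.
pose pi := perm (mc_succ_inj Ucc).
rewrite /mp_char /mp_det; set B := A + _.
apply: mp_le_trans (@mp_le_sum _ _ predT (fun s : 'S_n => _) pi isT).
have AB i j : A i j <=mp B i j by rewrite !mxE; apply: mp_le_addr.
have dB i : x%:mp <=mp B i i.
  by rewrite !mxE eqxx mulr1n addrC; apply: mp_le_addr.
rewrite (bigID (mem (flatten cc))) /=; apply: mp_le_mul.
  rewrite -(big_uniq _ (flatten_uniq mc)) /= big_flatten /mc_weight /=.
  rewrite [X in X <=mp _]big_seq [X in _ <=mp X]big_seq.
  apply: mp_le_prod => c ccc.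
  rewrite circuit_weightE ?(allP Ucc) // [X in X <=mp _]big_seq [X in _ <=mp X]big_seq.
  by apply: mp_le_prod => i ic; rewrite permE (mc_succ_in pw ccc ic).
have -> : (n - mc_length cc)%N = #|[predC flatten cc]|.
  have := cardC (mem (flatten cc)); rewrite card_ord mc_length_flatten => eqn.
  by rewrite -[X in (X - _)%N]eqn (card_uniqP (flatten_uniq mc)) addKn.
rewrite -prodr_const; apply: mp_le_prod => i icc.
by rewrite permE mc_succ_out.
Qed.

Lemma MMC_le x cc cc' : is_MMC A x cc -> is_multicircuit A cc' ->
  mc_weight A cc' * x%:mp ^+ (n - mc_length cc') <=mp
  mc_weight A cc * x%:mp ^+ (n - mc_length cc).
Proof. by move=> [_ <-]; apply: mc_weight_le_char. Qed.

Lemma mc_length_le cc : is_multicircuit A cc -> (mc_length cc <= n)%N.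
Proof.
move=> mc; rewrite mc_length_flatten -(card_uniqP (flatten_uniq mc)).
by rewrite -[n in (_ <= n)%N]card_ord max_card.
Qed.

Lemma mc_weight_neq0 cc : is_multicircuit A cc -> mc_weight A cc != 0.
Proof.
by case/andP=> /allP el _; apply: mp_prod_neq0 => c /el /circuit_weight_neq0.
Qed.

Lemma mp_exp_neq0 x m : x%:mp ^+ m != 0.
Proof. by rewrite fin_rmaxX. Qed.

(** Otherwise adding c to cc would improve on an optimal multi-circuit. *)
Lemma circuit_le_off_MMC x cc c : is_MMC A x cc -> elementary_circuit A c ->
  {in c, forall i, i \notin flatten cc} -> circuit_weight A c <=mp x%:mp ^+ size c.
Proof.
move=> mmc el out; have mc := mmc.1.
have mc' : is_multicircuit A (c :: cc).
  have [el' pw] := andP mc.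
  apply/andP; split=> /=; first by rewrite el.
  rewrite pw andbT; apply/allP=> d dcc; rewrite disjoint_subset; apply/subsetP=> i ic.
  by apply: contra (out i ic) => id; apply/flattenP; exists d.
have := MMC_le mmc mc'.
have len' := mc_length_le mc'.
rewrite /mc_weight /mc_length !big_cons -/(mc_weight A cc) -/(mc_length cc) in len' *.
have -> : (n - mc_length cc = size c + (n - (size c + mc_length cc)))%N by lia.
set y := _ ^+ (n - _); rewrite exprD -/y mulrA => le.
apply: (@mp_le_cancel _ (mc_weight A cc * y)).
  by rewrite mp_mul_eq0 negb_or mc_weight_neq0 //= mp_exp_neq0.
rewrite mulrAC [X in _ <=mp X]mulrAC.
by have -> : mc_weight A cc * circuit_weight A c * y =
  circuit_weight A c * mc_weight A cc * y by rewrite (mulrC (mc_weight A cc)).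
Qed.

(** Otherwise deleting c from cc would improve on an optimal multi-circuit. *)
Lemma circuit_ge_in_MMC x cc c : is_MMC A x cc -> c \in cc ->
  x%:mp ^+ size c <=mp circuit_weight A c.
Proof.
move=> mmc ccc; have mc := mmc.1; have pcc := perm_to_rem ccc.
set cc' := rem c cc in pcc; have mc' : is_multicircuit A cc'.
  have [/allP el pw] := andP mc; apply/andP; split.
    by apply/allP=> d /mem_rem/el.
  exact: subseq_pairwise (rem_subseq c cc) pw.
have := MMC_le mmc mc'.
have := mc_length_le mc.
have -> : mc_weight A cc = circuit_weight A c * mc_weight A cc'.
  by rewrite /mc_weight (perm_big _ pcc) big_cons.
have -> : mc_length cc = (size c + mc_length cc')%N.
  by rewrite /mc_length (perm_big _ pcc) big_cons.
move=> len; rewrite (_ : n - mc_length cc' =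
  size c + (n - (size c + mc_length cc')))%N; last by lia.
set y := _ ^+ (n - (_ + _)); rewrite exprD -/y => le.
apply: (@mp_le_cancel _ (mc_weight A cc' * y)).
  by rewrite mp_mul_eq0 negb_or mc_weight_neq0 //= mp_exp_neq0.
rewrite mulrAC (mulrC _ (circuit_weight A c)).
by rewrite -mulrA; move: le; rewrite -[X in _ <=mp X -> _]mulrA.
Qed.

End Circuits.

(** * Walks and closed walks *)

Section Walks.
Variables (R : realType) (n : nat).
Implicit Types (A : 'M[rmax R]_n) (c : circuit n) (i j : 'I_n) (p q : seq 'I_n).

(** The walk is the node sequence i :: p, of length size p. *)
Fixpoint walk_weight A i p : rmax R :=
  if p is j :: p' then A i j * walk_weight A j p' else 1.

Lemma walk_weight_cat A i p q :
  walk_weight A i (p ++ q) = walk_weight A i p * walk_weight A (last i p) q.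
Proof.
by elim: p i => [|j p IH] i /=; rewrite ?mul1r // IH mulrA.
Qed.

Lemma walk_weight_le_expmx A i p :
  walk_weight A i p <=mp (A ^+ size p) i (last i p).
Proof.
elim: p i => [|j p IH] i /=; first by rewrite expr0 mxE eqxx; apply: mp_le_refl.
rewrite exprS -mulmxE mxE.
apply: mp_le_trans (@mp_le_sum _ _ predT (fun k => A i k * _ k _) j isT).
by apply: mp_le_mul; [apply: mp_le_refl | apply: IH].
Qed.

(** Together with walk_weight_le_expmx this identifies the entries of A ^+ m with
    maximal weights of walks.  The factor a is what the induction on m needs. *)
Lemma mul_expmx_le A a i j m b :
  (forall p, size p = m -> last i p = j -> a * walk_weight A i p <=mp b) ->
  a * (A ^+ m) i j <=mp b.
Proof.
elim: m a i => [|m IH] a i le.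
  rewrite expr0 mxE; case: eqP => [ij|_]; first exact: (le [::]).
  by rewrite mulr0; apply: mp_le0.
rewrite exprS -mulmxE mxE mulr_sumr; apply: mp_sum_le => k _.
rewrite mulrA; apply: IH => p szp lastp.
by rewrite -mulrA; apply: (le (k :: p)) => //=; rewrite szp.
Qed.

Lemma expmxD_ge A i k j a b :
  (A ^+ a) i k * (A ^+ b) k j <=mp (A ^+ (a + b)) i j.
Proof.
rewrite exprD -mulmxE mxE.
exact: (@mp_le_sum _ _ predT (fun k => (A ^+ a) i k * (A ^+ b) k j)).
Qed.

Lemma circuit_weight_walk A i p :
  circuit_weight A (i :: p) = walk_weight A i (rcons p i).
Proof.
rewrite /circuit_weight /circuit_arcs rot1_cons.
elim: p {1 3}i => [|k p IH] j /=; first by rewrite big_cons big_nil.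
by rewrite big_cons IH.
Qed.

Lemma walk_weight_neq0 A i p : (walk_weight A i p != 0) = path (Defs.arc A) i p.
Proof. by elim: p i => //= j p IH i; rewrite mp_mul_eq0 negb_or IH. Qed.

(** A circuit, read as a closed walk starting at any of its nodes. *)
Lemma circuit_walk A c i : elementary_circuit A c -> i \in c ->
  exists p, [/\ last i p = i, size p = size c, p =i c &
                walk_weight A i p = circuit_weight A c].
Proof.
case/and3P=> _ Uc _ /rot_to[m p eqp]; exists (rcons p i); split.
- by rewrite last_rcons.
- by rewrite size_rcons -(size_rot m c) eqp.
- by move=> j; rewrite mem_rcons -eqp mem_rot.
- by rewrite -circuit_weight_walk -eqp circuit_weight_rot.
Qed.

(** A closed walk decomposes into elementary circuits. *)
Lemma closed_walk_le A (a : rmax R) (V : pred 'I_n) :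
  (forall c, elementary_circuit A c -> all V c ->
     circuit_weight A c <=mp a ^+ size c) ->
  forall i p, last i p = i -> all V p -> walk_weight A i p <=mp a ^+ size p.
Proof.
move=> circ i p; have [m] := ubnP (size p).
elim: m i p => // m IH i p lepm closed Vp.
have [w0|wN0] := eqVneq (walk_weight A i p) 0; first by rewrite w0; apply: mp_le0.
have [Up|] := boolP (uniq p).
  case/lastP: p => [|p k] in closed Vp wN0 Up lepm *; first exact: mp_le_refl.
  rewrite last_rcons in closed; rewrite closed {k closed} in Vp wN0 Up lepm *.
  rewrite -circuit_weight_walk (_ : size _ = size (i :: p)); last by rewrite size_rcons.
  rewrite walk_weight_neq0 in wN0.
  apply: circ; last by move: Vp; rewrite all_rcons.
  by apply/and3P; split=> //; move: Up; rewrite rcons_uniq.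
(* A repeated node k splits the closed walk into two shorter ones. *)
case/(uniqPn i) => a1 [a2 [lt12 lt2]] eqk.
set k := nth i p a1 in eqk.
have eqp : p = (take a1.+1 p ++ (take (a2 - a1) (drop a1.+1 p))) ++ drop a2.+1 p.
  rewrite -takeD (_ : (a1.+1 + (a2 - a1) = a2.+1)%N); last by lia.
  by rewrite cat_take_drop.
have lt1 : (a1 < size p)%N by exact: ltn_trans lt2.
have l1 : last i (take a1.+1 p) = k.
  by rewrite (take_nth i) // last_rcons.
have l2 : last i (take a1.+1 p ++ take (a2 - a1) (drop a1.+1 p)) = k.
  rewrite -takeD (_ : (a1.+1 + (a2 - a1) = a2.+1)%N); last by lia.
  by rewrite (take_nth i) // last_rcons -eqk.
move: eqp l1 l2; set p1 := take _ p; set p2 := take _ (drop _ _); set p3 := drop _ p.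
have sz2 : size p2 = (a2 - a1)%N by rewrite size_takel // size_drop -subSS leq_sub2r.
have sz1 : size p1 = a1.+1 by rewrite size_takel.
move=> eqp l1 l2; rewrite eqp in closed lepm Vp *.
rewrite !size_cat sz1 sz2 in lepm *.
have [Vp12 Vp3] := andP (etrans (esym (all_cat _ _ _)) Vp).
have [Vp1 Vp2] := andP (etrans (esym (all_cat _ _ _)) Vp12).
rewrite !walk_weight_cat l2 l1 !exprD mulrAC [X in _ <=mp X]mulrAC.
apply: mp_le_mul.
  rewrite -{1}l1 -walk_weight_cat -exprD -sz1 -size_cat.
  apply: IH; first by rewrite size_cat sz1; lia.
    by rewrite last_cat l1 -l2 -last_cat.
  by rewrite all_cat Vp1.
rewrite -sz2; apply: IH => //; first by rewrite sz2; lia.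
by rewrite -{1}l1 -last_cat.
Qed.

(** Pigeonhole on the pairs (node, position modulo l). *)
Lemma closed_subwalk i p l : (0 < l)%N -> (n * l <= size p)%N ->
  exists p1 p2 p3, [/\ p = p1 ++ p2 ++ p3, last i (p1 ++ p2) = last i p1,
                       (0 < size p2)%N & (l %| size p2)%N].
Proof.
move=> l0 szp.
pose f (a : 'I_(n * l).+1) : 'I_n * 'I_l :=
  (nth i (i :: p) a, Ordinal (ltn_pmod a l0)).
have /injectivePn[a [b neq eqf]] : ~~ injectiveb f.
  apply/negP=> /injectiveP/leq_card.
  by rewrite card_prod !card_ord ltnn.
wlog ltab : a b neq eqf / (a < b)%N.
  move=> W; case: (ltngtP a b) => [|ba|/val_inj eqab]; first exact: (W a b).
    by apply: (W b a) => //; rewrite eq_sym.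
  by rewrite eqab eqxx in neq.
case: eqf => eqn eqm.
have leb : (b <= size p)%N by apply: leq_trans szp; rewrite -ltnS.
have lea : (a <= size p)%N by lia.
have lastt m : (m <= size p)%N -> last i (take m p) = nth i (i :: p) m.
  by case: m => [|m] lt; rewrite ?take0 //= (take_nth i) // last_rcons.
exists (take a p), (take (b - a) (drop a p)), (drop b p).
have eqb : take a p ++ take (b - a) (drop a p) = take b p.
  by rewrite -takeD subnKC // ltnW.
have sz2 : size (take (b - a) (drop a p)) = (b - a)%N.
  by rewrite size_takel // size_drop; lia.
split; rewrite ?sz2.
- by rewrite catA eqb cat_take_drop.
- by rewrite eqb !lastt.
- by rewrite subn_gt0.
- by rewrite -eqn_mod_dvd ?(ltnW ltab) //; apply/eqP.
Qed.

(** Closed subwalks of length divisible by l are removed as long as there are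
    any; each costs at most its length times the bound a on circuit means. *)
Lemma shorten_walk A (a : rmax R) l i p : (0 < l)%N ->
  (forall j q, last j q = j -> walk_weight A j q <=mp a ^+ size q) ->
  exists q, [/\ (size q < n * l)%N, size q = size p %[mod l],
    (size q <= size p)%N, last i q = last i p &
    walk_weight A i p <=mp a ^+ (size p - size q) * walk_weight A i q].
Proof.
move=> l0 closed; have [m] := ubnP (size p); elim: m p => // m IH p ltpm.
have [szp|szp] := ltnP (size p) (n * l).
  by exists p; rewrite subnn mul1r; split=> //; apply: mp_le_refl.
have [p1 [p2 [p3 [eqp l12 sz2 dvd]]]] := closed_subwalk i l0 szp.
have szpE : size p = (size (p1 ++ p3) + size p2)%N.
  by rewrite eqp !size_cat; lia.
have [|q [sq mq leq lq wq]] := IH (p1 ++ p3); first by lia.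
exists q; split=> //.
- rewrite mq szpE -modnDmr.
  by move/eqP: dvd => ->; rewrite addn0.
- by lia.
- by rewrite lq eqp !last_cat -[last _ p2]last_cat l12.
rewrite szpE (_ : (_ - _ = size p2 + (size (p1 ++ p3) - size q))%N); last by lia.
rewrite exprD -mulrA eqp.
apply: mp_le_trans (mp_le_mul (mp_le_refl _) wq).
rewrite catA !walk_weight_cat l12 mulrAC mulrC.
apply: mp_le_mul; last exact: mp_le_refl.
by apply: closed; rewrite -last_cat.
Qed.

End Walks.

(** * The term of a quasi-critical circuit *)

Section CSR.
Variables (R : realType) (n : nat) (A : 'M[rmax R]_n) (V : pred 'I_n).
Variables (x : R) (c : circuit n).

Definition restrict_mx : 'M[rmax R]_n :=
  \matrix_(i, j) if V i && V j then A i j else 0.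

Local Notation B := restrict_mx.
Local Notation l := (size c).

(** Position 0 of c, its head, serves as base node.  A walk of length m from i to
    the base is filed under the position u with m + u = 0 modulo l, and a walk of
    length m from the base under the position m modulo l: advancing by t positions
    from u to v then forces the two lengths to add up to t modulo l. *)
Definition csr_left : 'M[rmax R]_(n, l) :=
  \matrix_(i, u) \sum_(m < n * l | (l %| m + u)%N)
    ((- x)%:mp ^+ m * (B ^+ m) i (head i c)).

Definition csr_right : 'M[rmax R]_(l, n) :=
  \matrix_(v, j) \sum_(m < n * l | (m %% l == v)%N)
    ((- x)%:mp ^+ m * (B ^+ m) (head j c) j).

Lemma restrict_mx_le i j : B i j <=mp A i j.
Proof. by rewrite mxE; case: ifP => _; [apply: mp_le_refl|apply: mp_le0]. Qed.

Lemma restrict_walk_le i p : walk_weight B i p <=mp walk_weight A i p.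
Proof.
elim: p i => [|j p IH] i /=; first exact: mp_le_refl.
by apply: mp_le_mul => //; apply: restrict_mx_le.
Qed.

Lemma restrict_walk i p : all V (i :: p) -> walk_weight B i p = walk_weight A i p.
Proof.
elim: p i => //= j p IH i /and3P[Vi Vj Vp].
by rewrite IH /= ?Vj // mxE Vi Vj.
Qed.

Lemma restrict_walk_in i p : walk_weight B i p != 0 -> all V p.
Proof.
rewrite walk_weight_neq0; elim: p i => //= j p IH i /andP[Bij /IH ->].
by move: Bij; rewrite /Defs.arc mxE; case: (V j); rewrite // andbF eqxx.
Qed.

Lemma restrict_expmx_le m i j : (B ^+ m) i j <=mp (A ^+ m) i j.
Proof.
rewrite -[X in X <=mp _]mul1r; apply: mul_expmx_le => p <- <-; rewrite mul1r.
by apply: mp_le_trans (restrict_walk_le _ _) _; apply: walk_weight_le_expmx.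
Qed.

Lemma next_nth_mod d k : uniq c -> (k < l)%N ->
  next c (nth d c k) = nth d c (k.+1 %% l)%N.
Proof.
move=> Uc ltk; rewrite next_nth mem_nth // index_uniq //.
case: c Uc ltk => //= y c' _; rewrite ltnS leq_eqVlt => /orP[/eqP->|lt].
  by rewrite modnn nth_default.
by rewrite modn_small //=; apply: set_nth_default.
Qed.

Lemma circuit_mxE (u v : 'I_l) : uniq c ->
  circuit_mx R c u v = if (u.+1 %% l == v)%N then 1 else 0.
Proof.
move=> Uc; rewrite mxE circuit_arcsE //; congr (if _ then _ else _).
have l0 : (0 < l)%N by apply: leq_ltn_trans (ltn_ord u).
set i := tnth _ u; have -> : (i, tnth (in_tuple c) v) \in [seq (i, next c i) | i <- c]
   = (tnth (in_tuple c) v == next c i).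
  apply/mapP/eqP => [[k kc [-> ->]] //|->]; exists i => //; exact: mem_tnth.
by rewrite {1}/i !(tnth_nth i) /= next_nth_mod // nth_uniq ?ltn_pmod // eq_sym.
Qed.

Lemma expr_circuit_mx t (u v : 'I_l) : uniq c ->
  (circuit_mx R c ^+ t) u v = if ((u + t) %% l == v)%N then 1 else 0.
Proof.
move=> Uc; have l0 : (0 < l)%N by apply: leq_ltn_trans (ltn_ord u).
elim: t u => [|t IH] u.
  by rewrite expr0 mxE addn0 modn_small // -val_eqE; case: eqP.
rewrite exprS -mulmxE mxE (bigD1 (Ordinal (ltn_pmod u.+1 l0))) //=.
rewrite circuit_mxE // eqxx mul1r big1 ?addr0 => [|w neq].
  by rewrite IH /= modnDml addSnnS.
rewrite circuit_mxE //; case: eqP => [eqw|_]; last by rewrite mul0r.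
by case/eqP: neq; apply: val_inj; rewrite /= eqw.
Qed.

Hypothesis el : elementary_circuit A c.
Hypothesis Vc : all V c.
Hypothesis x_le_c : x%:mp ^+ l <=mp circuit_weight A c.
Hypothesis closed_le_x : forall i p, last i p = i -> all V p ->
  walk_weight A i p <=mp x%:mp ^+ size p.

Lemma csr_uniq : uniq c. Proof. by case/and3P: el. Qed.
Lemma csr_size_gt0 : (0 < l)%N.
Proof. by case/and3P: el; case: c. Qed.

Lemma csr_head i j : head i c = head j c.
Proof. by move: csr_size_gt0; case: c. Qed.

Lemma csr_head_in i : head i c \in c.
Proof. by move: csr_size_gt0; case: c => //= k c' _; apply: mem_head. Qed.

Lemma csr_entry t i j :
  (csr_left *m circuit_mx R c ^+ t *m csr_right) i j =
  \sum_(v < l) (\sum_(u < l) csr_left i u * (circuit_mx R c ^+ t) u v) *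
    csr_right v j.
Proof. by rewrite mxE; apply: eq_bigr => v _; rewrite mxE. Qed.

(** The two walks recorded in the factors are joined by as many turns around c as
    the length t requires; each turn gains at least l times x. *)
Lemma csr_le t i j : (2 * (n * l) <= t)%N ->
  x%:mp ^+ t * (csr_left *m circuit_mx R c ^+ t *m csr_right) i j
    <=mp (A ^+ t) i j.
Proof.
move=> let_; have l0 := csr_size_gt0; have Uc := csr_uniq.
rewrite csr_entry mulr_sumr; apply: mp_sum_le => v _.
rewrite mulr_suml mulr_sumr; apply: mp_sum_le => u _.
rewrite expr_circuit_mx //; case: eqP => [uv|_]; last first.
  by rewrite mulr0 mul0r mulr0; apply: mp_le0.
rewrite mulr1 !mxE mulr_suml mulr_sumr; apply: mp_sum_le => m1 dv1.
rewrite !mulr_sumr; apply: mp_sum_le => m2 /eqP eq2.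
rewrite (csr_head j i); set h := head i c.
have lt1 := ltn_ord m1; have lt2 := ltn_ord m2.
have /dvdnP[q eqt] : (l %| t - (m1 + m2))%N.
  rewrite -eqn_mod_dvd; last by lia.
  have : (u + t = m2 %[mod l])%N by rewrite eq2 uv.
  move/eqP=> e; rewrite -(eqn_modDl u) (eqP e) addnA [(u + m1)%N]addnC.
  by rewrite -modnDml (eqP dv1) add0n.
have [p [lastp szp _ wp]] := circuit_walk el (csr_head_in i).
have stay k : x%:mp ^+ (k * l) <=mp (A ^+ (k * l)) h h.
  elim: k => [|k IH]; first by rewrite mul0n !expr0 mxE eqxx; apply: mp_le_refl.
  rewrite mulSn exprD; apply: mp_le_trans (expmxD_ge A h h h l (k * l)).
  apply: mp_le_mul IH; apply: mp_le_trans x_le_c _.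
  by have := walk_weight_le_expmx A h p; rewrite lastp szp wp.
have tE : t = (m1 + (q * l + m2))%N by lia.
rewrite [in (A ^+ _)]tE.
apply: mp_le_trans (expmxD_ge A i h j m1 _).
apply: mp_le_trans (mp_le_mul (mp_le_refl _) (expmxD_ge A h h j (q * l) m2)).
have -> : x%:mp ^+ t * ((- x)%:mp ^+ m1 * (B ^+ m1) i h *
    ((- x)%:mp ^+ m2 * (B ^+ m2) h j)) =
  (x%:mp ^+ m1 * (- x)%:mp ^+ m1) * (x%:mp ^+ m2 * (- x)%:mp ^+ m2) *
  ((B ^+ m1) i h * (x%:mp ^+ (q * l) * (B ^+ m2) h j)).
  by rewrite tE !exprD; ring.
rewrite !mp_mulVr !mul1r.
by do 2?[apply: mp_le_mul]; try exact: restrict_expmx_le; apply: stay.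
Qed.

Lemma csr_reduce i p : exists m, [/\ (m < n * l)%N, m = size p %[mod l],
  (m <= size p)%N &
  walk_weight B i p <=mp x%:mp ^+ (size p - m) * (B ^+ m) i (last i p)].
Proof.
have closedB j q : last j q = j -> walk_weight B j q <=mp x%:mp ^+ size q.
  move=> lastq; have [->|N0] := eqVneq (walk_weight B j q) 0; first exact: mp_le0.
  apply: mp_le_trans (restrict_walk_le _ _) _.
  exact: closed_le_x lastq (restrict_walk_in N0).
have [q [szq mq leq lastq wq]] := shorten_walk i p csr_size_gt0 closedB.
exists (size q); split=> //; apply: mp_le_trans wq _.
by rewrite -lastq; apply: mp_le_mul (walk_weight_le_expmx _ _ _); apply: mp_le_refl.
Qed.

(** One extra turn around c, started at the common node k, makes the walk pass
    through the base node.  Its weight is at least l times x, and exactly this amount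
    is cancelled at the end. *)
Lemma csr_ge i p k : all V (i :: p) -> k \in i :: p -> k \in c ->
  walk_weight A i p <=mp x%:mp ^+ size p *
    (csr_left *m circuit_mx R c ^+ size p *m csr_right) i (last i p).
Proof.
have l0 := csr_size_gt0; have Uc := csr_uniq.
move=> Vp ki kc; set h := head i c; case/splitPl: ki Vp => p1 p2 last1 Vp.
have [q [lastq szq qc wq]] := circuit_walk el kc.
have hq : h \in k :: q by rewrite inE qc csr_head_in orbT.
case/splitPl: hq lastq szq qc wq => q1 q2 lastq1 lastq2 szq qc wq.
have Vk : V k by apply: (allP Vc).
have Vq : all V (q1 ++ q2) by apply/allP=> y; rewrite qc => /(allP Vc).
have Vh : V h by apply/(allP Vc)/csr_head_in.
move: Vp; rewrite /= all_cat => /and3P[Vi Vp1 Vp2].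
move: Vq; rewrite all_cat => /andP[Vq1 Vq2].
have last2 : last h q2 = k by rewrite -lastq2 last_cat lastq1.
apply: (@mp_le_cancel _ (x%:mp ^+ l)); first exact: mp_exp_neq0.
apply: mp_le_trans (mp_le_mul x_le_c (mp_le_refl _)) _.
rewrite -wq !walk_weight_cat lastq1 last1 !last_cat last1.
set a := _ * _ * _.
have {a}-> : a = walk_weight B i (p1 ++ q1) * walk_weight B h (q2 ++ p2).
  rewrite !restrict_walk /= ?all_cat ?Vi ?Vh ?Vp1 ?Vq1 ?Vq2 ?Vp2 //.
  by rewrite !walk_weight_cat last1 last2 /a; ring.
(* The lengthened walk is cut at the base node h and both parts are reduced. *)
have [m1 [lt1 eq1 le1 w1]] := csr_reduce i (p1 ++ q1).
have [m2 [lt2 eq2 le2 w2]] := csr_reduce h (q2 ++ p2).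
apply: mp_le_trans (mp_le_mul w1 w2) _.
rewrite !last_cat last1 last2 lastq1.
rewrite csr_entry.
pose v := Ordinal (ltn_pmod m2 l0).
pose u := Ordinal (ltn_pmod (l - m1 %% l) l0).
set T := size (p1 ++ p2).
have szl : (size q1 + size q2 = l)%N by rewrite -size_cat.
have dv1 : (l %| m1 + u)%N.
  rewrite /dvdn /= modnDmr -modnDml addnC subnK ?modnn //.
  by rewrite ltnW // ltn_pmod.
have uv : ((u + T) %% l == v)%N.
  rewrite /= -(eqn_modDl m1) addnA -modnDml (eqP dv1) add0n.
  rewrite -modnDm eq1 eq2 modnDm /T !size_cat.
  rewrite [(size q2 + _)%N]addnC addnACA.
  by rewrite szl modnDr; apply/eqP.
apply: mp_le_trans (mp_le_mul (mp_le_refl (x%:mp ^+ l)) (mp_le_mul (mp_le_refl (x%:mp ^+ T))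
  (@mp_le_sum _ _ predT (fun v => _ * csr_right v _) v isT))).
apply: mp_le_trans (mp_le_mul (mp_le_refl (x%:mp ^+ l)) (mp_le_mul (mp_le_refl (x%:mp ^+ T))
  (mp_le_mul (@mp_le_sum _ _ predT (fun u => csr_left i u * (circuit_mx R c ^+ T) u v) u isT) (mp_le_refl _)))).
rewrite expr_circuit_mx // uv mulr1 !mxE.
apply: mp_le_trans (mp_le_mul (mp_le_refl (x%:mp ^+ l)) (mp_le_mul (mp_le_refl (x%:mp ^+ T))
  (mp_le_mul (@mp_le_sum _ _ (fun m : 'I__ => l %| m + u)%N _ (Ordinal lt1) dv1)
    (@mp_le_sum _ _ (fun m : 'I__ => m %% l == v)%N _ (Ordinal lt2) (eqxx _))))).
rewrite /= (csr_head _ i) -/h.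
have eqT : (l + T = (size (p1 ++ q1) - m1) + m1 + ((size (q2 ++ p2) - m2) + m2))%N.
  by rewrite !subnK // /T !size_cat -szl; clear; lia.
set X := (X in _ <=mp X).
have -> : X = x%:mp ^+ (l + T) * ((- x)%:mp ^+ m1 * (B ^+ m1) i h *
    ((- x)%:mp ^+ m2 * (B ^+ m2) h (last k p2))).
  by rewrite /X exprD -!mulrA.
rewrite eqT !exprD; set y1 := _ ^+ (_ - m1); set y2 := _ ^+ (_ - m2).
have -> : y1 * x%:mp ^+ m1 * (y2 * x%:mp ^+ m2) *
  ((- x)%:mp ^+ m1 * (B ^+ m1) i h * ((- x)%:mp ^+ m2 * (B ^+ m2) h (last k p2))) =
  (x%:mp ^+ m1 * (- x)%:mp ^+ m1) * (x%:mp ^+ m2 * (- x)%:mp ^+ m2) *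
   (y1 * (B ^+ m1) i h * (y2 * (B ^+ m2) h (last k p2))) by ring.
by rewrite !mp_mulVr !mul1r; apply: mp_le_refl.
Qed.

End CSR.

(** * Exchanging closed subwalks for turns around a circuit *)

Section Splice.
Variables (R : realType) (n : nat) (A : 'M[rmax R]_n) (V : pred 'I_n) (x : R).
Hypothesis closed_le_x : forall i p, last i p = i -> all V p ->
  walk_weight A i p <=mp x%:mp ^+ size p.

Lemma excise_closed_subwalk i p l : (0 < l)%N -> (n * l <= size p)%N -> all V p ->
  exists q m, [/\ (0 < m)%N, size p = (size q + m * l)%N, last i q = last i p &
    walk_weight A i p <=mp x%:mp ^+ (m * l) * walk_weight A i q].
Proof.
move=> l0 szp Vp; have [p1 [p2 [p3 [eqp l12 sz2 /dvdnP[m eqm]]]]] := closed_subwalk i l0 szp.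
exists (p1 ++ p3), m; split.
- by case: m eqm sz2 => // ->.
- by rewrite eqp !size_cat -eqm addnA addnAC.
- by rewrite eqp !last_cat -[last _ p2]last_cat l12.
move: Vp; rewrite eqp !all_cat => /and3P[_ Vp2 _].
rewrite catA !walk_weight_cat l12 mulrAC [X in X <=mp _]mulrC -eqm.
by apply: mp_le_mul (mp_le_refl _); apply: closed_le_x => //; rewrite -last_cat.
Qed.

(** Split at k, one of the two parts of the walk has length at least n * size c,
    which is where the bound 2 n^2 comes from. *)
Lemma splice_circuit c i p k : elementary_circuit A c ->
  x%:mp ^+ size c <=mp circuit_weight A c ->
  all V p -> k \in i :: p -> k \in c -> (2 * (n * size c) <= size p)%N ->
  exists q, [/\ size q = size p, last i q = last i p, {subset c <= q} &
    walk_weight A i p <=mp walk_weight A i q].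
Proof.
move=> el lec Vp ki kc; have [z [lastz szz zc wz]] := circuit_walk el kc.
have l0 : (0 < size c)%N by case: (c) kc.
pose turns m := flatten (nseq m z).
have last_turns m : last k (turns m) = k.
  by elim: m => //= m IH; rewrite last_cat lastz.
have size_turns m : size (turns m) = (m * size c)%N.
  by elim: m => //= m IH; rewrite size_cat IH szz.
have weight_turns m : x%:mp ^+ (m * size c) <=mp walk_weight A k (turns m).
  elim: m => [|m IH]; first exact: mp_le_refl.
  rewrite mulSn exprD walk_weight_cat lastz; apply: mp_le_mul IH.
  by rewrite wz.
have sub_turns m : (0 < m)%N -> {subset c <= turns m}.
  by case: m => //= m _ y; rewrite mem_cat zc => ->.
case/splitPl: ki Vp => p1 p2 last1.
rewrite all_cat size_cat => /andP[Vp1 Vp2] szp.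
have [sz1|sz1] := leqP (n * size c) (size p1).
  have [q [m [m0 szq lastq wq]]] := excise_closed_subwalk i l0 sz1 Vp1.
  exists (q ++ turns m ++ p2); split.
  - by rewrite szq !size_cat size_turns addnA.
  - by rewrite !last_cat lastq last1 last_turns.
  - by move=> y yc; rewrite !mem_cat (sub_turns m m0 y yc) orbT.
  rewrite !walk_weight_cat lastq last1 last_turns.
  rewrite mulrA; apply: mp_le_mul (mp_le_refl _); apply: mp_le_trans wq _.
  by rewrite mulrC; apply: mp_le_mul (mp_le_refl _) _.
have sz2 : (n * size c <= size p2)%N.
  rewrite leqNgt; apply/negP => sz2; move: szp; rewrite leqNgt => /negP[].
  by rewrite mul2n -addnn -addSn; apply: leq_add sz1 (ltnW sz2).
have [q [m [m0 szq lastq wq]]] := excise_closed_subwalk k l0 sz2 Vp2.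
exists (p1 ++ turns m ++ q); split.
- by rewrite szq !size_cat size_turns [(size q + _)%N]addnC.
- by rewrite !last_cat last1 last_turns.
- by move=> y yc; rewrite !mem_cat (sub_turns m m0 y yc) orbT.
rewrite !walk_weight_cat last1 last_turns.
apply: mp_le_mul (mp_le_refl _) _; apply: mp_le_trans wq _.
exact: mp_le_mul (weight_turns m) (mp_le_refl _).
Qed.

End Splice.

(** * Quasi-critical circuits in the node partition procedure *)

Section Partition.
Variable n : nat.
Implicit Types (L : seq (nat * circuit n)) (b : block n) (i : 'I_n).

Definition outside L : pred 'I_n := fun i => all (fun kc => i \notin kc.2) L.

Definition block_key b : nat * circuit n := (block_index b, block_circuit b).

Lemma block_key_add_to_last U bs :
  [seq block_key b | b <- add_to_last U bs] = [seq block_key b | b <- bs].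
Proof. by case: bs. Qed.

(** A block is created exactly by a circuit disjoint from all its predecessors;
    later steps change its nodes but not its key. *)
Lemma foldl_partition_step L :
  let st := foldl (@partition_step n) (set0, [::]) L in
  (forall i, (i \in st.1) = ~~ outside L i) /\
  forall kc, kc \in [seq block_key b | b <- st.2] <->
    exists d, [/\ (d < size L)%N, nth (0%N, [::]) L d = kc &
                  all (outside (take d L)) kc.2].
Proof.
elim/last_ind: L => [|L [k c] /=] /=.
  by split=> [i|kc]; [rewrite inE | split=> // -[d []]].
rewrite foldl_rcons; case: foldl => U bs /= [Uout keys]; split=> [i|kc].
  by rewrite !inE Uout /outside all_rcons /= negb_and negbK orbC.
have -> : (kc \in [seq block_key b | b <-
    if [set i in c] :&: U != set0 then add_to_last ([set i in c] :\: U) bs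
    else Block [set i in c] c k :: bs]) =
   (all (outside L) c && (kc == (k, c))) || (kc \in [seq block_key b | b <- bs]).
  have -> : ([set i in c] :&: U != set0) = ~~ all (outside L) c.
    apply/set0Pn/allPn => [[i]|[i ic iU]]; rewrite ?inE; last first.
      by exists i; rewrite !inE ic Uout.
    by rewrite Uout => /andP[ic iL]; exists i.
  case: all => /=; last by rewrite block_key_add_to_last.
  by rewrite inE.
split=> [/orP[/andP[out /eqP ->]|/keys[d [ltd nthd out]]]|[d []]].
- exists (size L); rewrite size_rcons ltnSn nth_rcons ltnn eqxx -cats1 take_size_cat //.
- by exists d; rewrite size_rcons ltnS ltnW // nth_rcons ltd -cats1 takel_cat // ltnW.
rewrite size_rcons ltnS leq_eqVlt => /orP[/eqP->|ltd].
  rewrite nth_rcons ltnn eqxx -cats1 take_size_cat // => <- ->.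
  by rewrite eqxx.
rewrite nth_rcons ltd -cats1 takel_cat ?(ltnW ltd) // => nthd out.
by apply/orP; right; apply/keys; exists d.
Qed.

Lemma outside_take L d e : (d <= e)%N -> subpred (outside (take e L)) (outside (take d L)).
Proof.
move=> lede i; rewrite /outside -(subnKC lede) takeD all_cat.
by case/andP.
Qed.

Lemma mem_node_partition (ccs : seq (multicircuit n)) kc :
  let L := indexed_circuits ccs in
  kc \in [seq block_key b | b <- node_partition ccs] <->
    exists d, [/\ (d < size L)%N, nth (0%N, [::]) L d = kc &
                  all (outside (take d L)) kc.2].
Proof.
move=> L; have [_ <-] := foldl_partition_step L.
rewrite /node_partition -/L; case: foldl => U bs.
by rewrite map_rev mem_rev block_key_add_to_last.
Qed.

(** The first occurrence in the list is a position of the circuit that depends on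
    the block only. *)
Lemma mem_node_partition_index (ccs : seq (multicircuit n)) kc :
  let L := indexed_circuits ccs in
  kc \in [seq block_key b | b <- node_partition ccs] ->
  [/\ kc \in L & all (outside (take (index kc L) L)) kc.2].
Proof.
move=> L /mem_node_partition; rewrite -/L => -[d [ltd nthd out]].
have kcL : kc \in L by rewrite -nthd mem_nth.
split=> //; apply: sub_all out; apply: outside_take.
rewrite leqNgt; apply/negP => /(before_find (0%N, [::])).
by rewrite nthd /= eqxx.
Qed.

Lemma pairwise_indexed (s : seq nat) (f : nat -> seq (circuit n)) :
  pairwise leq s ->
  pairwise (fun a b : nat * circuit n => a.1 <= b.1)%N [seq (k, c) | k <- s, c <- f k].
Proof.
elim: s => //= k s IH /andP[/allP lek /IH pw]; rewrite pairwise_cat pw andbT.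
apply/andP; split.
  apply/allrelP => _ _ /mapP[c _ ->] /allpairsPdep[k' [c' [ks _ ->]]] /=.
  exact: lek.
by rewrite pairwise_map; elim: (f k) => //= c cs ->; rewrite andbT; apply/allP => c2 _ /=.
Qed.

Lemma mem_indexed_circuits (ccs : seq (multicircuit n)) k c :
  ((k, c) \in indexed_circuits ccs) =
  (0 < k < size ccs)%N && (c \in nth [::] ccs k).
Proof.
apply/allpairsPdep/andP => [[k' [c' [ks cc [-> ->]]]]|[lek cc]].
  by split=> //; move: ks; rewrite mem_iota; lia.
by exists k, c; split=> //; rewrite mem_iota; lia.
Qed.

Lemma indexed_circuits_before (ccs : seq (multicircuit n)) d k c k' c' :
  let L := indexed_circuits ccs in
  (d < size L)%N -> nth (0%N, [::]) L d = (k, c) -> (0 < k' < k)%N ->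
  c' \in nth [::] ccs k' -> (k', c') \in take d L.
Proof.
move=> L ltd nthd /andP[k'0 ltk] c'c.
have kL : (k, c) \in L by rewrite -nthd mem_nth.
have k'L : (k', c') \in L.
  move: kL; rewrite !mem_indexed_circuits => /andP[/andP[_ lt] _].
  by rewrite c'c k'0 (ltn_trans ltk).
move: (k'L); rewrite -{1}(cat_take_drop d L) mem_cat => /orP[//|].
rewrite (drop_nth (0%N, [::]) ltd) nthd inE => /orP[/eqP[eqk _]|].
  by rewrite eqk ltnn in ltk.
move=> inr; have : pairwise (fun a b : nat * circuit n => a.1 <= b.1)%N (drop d L).
  apply: (subseq_pairwise (drop_subseq _ _)); apply: pairwise_indexed.
  by rewrite -sorted_pairwise ?iota_sorted //; apply: leq_trans.
rewrite (drop_nth (0%N, [::]) ltd) nthd /= => /andP[/allP/(_ _ inr) /= + _].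
by rewrite leqNgt ltk.
Qed.

End Partition.

(** * Walks and maximal multi-circuit sequences *)

Section MMCS.
Variables (R : realType) (n : nat) (A : 'M[rmax R]_n) (lam : seq R).
Variable ccs : seq (multicircuit n).
Hypothesis lam_sorted : sorted >%R lam.
Hypothesis hccs : is_MMCS A lam ccs.
Local Notation L := (indexed_circuits ccs).
Local Notation lambda k := (fine (root_at lam k)).

Lemma root_atE k : (0 < k <= size lam)%N -> root_at lam k = (lambda k)%:E.
Proof.
case: k => // k lek; rewrite /root_at /= (nth_map 0) //.
Qed.

Lemma root_at_le k : (root_at lam k.+1 <= root_at lam k)%E.
Proof.
have [ltk|gek] := ltnP k (size lam); last first.
  by rewrite {1}/root_at nth_default /= ?size_map // leNye.
case: k ltk => [|k] ltk; first by rewrite /root_at /= leey.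
rewrite /root_at /= !(nth_map 0) ?(ltnW ltk) // lee_fin ltW //.
by have /(sortedP 0)/(_ k ltk) := lam_sorted.
Qed.

(** The root lambda_k is a common end point of the intervals on which C_(k-1) and
    C_k are optimal. *)
Lemma indexed_MMC k c : (k, c) \in L ->
  is_MMC A (lambda k) (nth [::] ccs k.-1) /\ is_MMC A (lambda k) (nth [::] ccs k).
Proof.
rewrite mem_indexed_circuits; case: hccs => -> _ mmc /andP[/andP[k0 lek] _].
split; last first.
  apply: (mmc k lek).2; rewrite -root_atE ?k0 // root_at_le lexx //.
have lek' : (k.-1 <= size lam)%N by lia.
apply: (mmc _ lek').2; rewrite prednK // -root_atE ?k0 // lexx.
by rewrite -{1}(prednK k0) root_at_le.
Qed.

Lemma indexed_elementary k c : (k, c) \in L -> elementary_circuit A c.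
Proof.
move=> kcL; have [_ [/andP[/allP el _] _]] := indexed_MMC kcL.
by apply: el; move: kcL; rewrite mem_indexed_circuits => /andP[].
Qed.

Lemma indexed_circuit_ge k c : (k, c) \in L ->
  (lambda k)%:mp ^+ size c <=mp circuit_weight A c.
Proof.
move=> kcL; have [_ mmc] := indexed_MMC kcL; apply: circuit_ge_in_MMC mmc _.
by move: kcL; rewrite mem_indexed_circuits => /andP[].
Qed.

Lemma MMC_closed_walk_le x cc i p : is_MMC A x cc -> last i p = i ->
  all (fun k => k \notin flatten cc) p -> walk_weight A i p <=mp x%:mp ^+ size p.
Proof.
move=> mmc; apply: closed_walk_le => c el /allP out.
exact: circuit_le_off_MMC mmc el out.
Qed.

(** The circuits before a circuit of C_k include the whole of C_(k-1). *)
Lemma closed_walk_outside_le d k c i p : (d < size L)%N ->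
  nth (0%N, [::]) L d = (k, c) -> last i p = i -> all (outside (take d L)) p ->
  walk_weight A i p <=mp (lambda k)%:mp ^+ size p.
Proof.
move=> ltd nthd lastp outp.
have kcL : (k, c) \in L by rewrite -nthd mem_nth.
have [mmc _] := indexed_MMC kcL.
apply: MMC_closed_walk_le mmc lastp _; apply: sub_all outp => y /allP outy.
apply/flattenP => -[c' c'c yc'].
have [k1|k1] := posnP k.-1.
  by case: hccs c'c => _ nil0 _; rewrite k1 nil0.
have /outy /= : (k.-1, c') \in take d L.
  apply: (indexed_circuits_before ltd nthd) c'c.
  by rewrite k1 /=; move: k1; case: (k) => [|k'] //= _; apply: ltnSn.
by rewrite yc'.
Qed.

(** A closed subwalk avoiding C_p would have mean at most every x below lambda_p. *)
Lemma walk_hits i p : (n <= size p)%N -> walk_weight A i p != 0 ->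
  has (fun kc : nat * circuit n => has (mem kc.2) (i :: p)) L.
Proof.
move=> szp w0; apply: contraT => /hasPn out.
have [|p1 [p2 [p3 [eqp l12 sz2 _]]]] := @closed_subwalk n i p 1 isT; first by rewrite muln1.
have [b ltb] : exists b : R, forall x, x <= b -> (x%:E <= root_at lam (size lam))%E.
  have [sz0|sz0] := posnP (size lam).
    by exists 0 => x _; rewrite sz0 /root_at /= leey.
  by exists (lambda (size lam)) => x lex; rewrite root_atE ?sz0 ?leqnn // lee_fin.
have := w0; rewrite eqp !walk_weight_cat !mp_mul_eq0 !negb_or => /and3P[_ + _].
case/mp_neq0P=> w eqw.
(* At this x below lambda_p, no m > 0 satisfies w <= x *+ m. *)
pose x := Num.min b (- (`|w| + 1)).
have lexw : x <= - (`|w| + 1) by rewrite ge_min lexx orbT.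
case: hccs => szccs _ /(_ (size lam) (leqnn _))[_ /(_ x)].
rewrite {1}/root_at nth_default /= ?size_map // leNye ltb ?ge_min ?lexx // => /(_ isT) mmc.
have closed : last (last i p1) p2 = last i p1 by rewrite -last_cat.
have := MMC_closed_walk_le mmc closed; rewrite eqw fin_rmaxX => le.
have : w <= x *+ size p2.
  apply/mp_le_fin/le/allP => y yp2; apply/flattenP => -[c cc yc].
  have [sz0|sz0] := posnP (size lam).
    by case: hccs cc => _ nil0 _; rewrite sz0 nil0.
  have /out /hasPn/(_ y) : (size lam, c) \in L.
    by rewrite mem_indexed_circuits szccs sz0 ltnSn.
  by rewrite eqp inE !mem_cat yp2 orbT /= orbT yc => /(_ isT).
case: (size p2) sz2 => // m _; rewrite mulrS => lew.
have xm : x *+ m <= 0.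
  by rewrite mulrn_wle0 //; apply: le_trans lexw _; rewrite oppr_le0 addr_ge0.
have := ler_norm (- w); rewrite normrN; lra.
Qed.

(** Induction on the position d in the list of the first circuit met by the walk:
    if this circuit meets an earlier one, running around it brings the walk to an
    earlier circuit. *)
Lemma walk_to_fresh_circuit i p : (2 * n ^ 2 <= size p)%N -> walk_weight A i p != 0 ->
  exists q d, [/\ size q = size p, last i q = last i p,
    walk_weight A i p <=mp walk_weight A i q & (d < size L)%N] /\
    let kc := nth (0%N, [::]) L d in
    [/\ all (outside (take d L)) (i :: q), has (mem kc.2) (i :: q) &
        all (outside (take d L)) kc.2].
Proof.
move=> szp; pose hit p (kc : nat * circuit n) := has (mem kc.2) (i :: p).
have [m] := ubnP (find (hit p) L); elim: m p szp => // m IH p szp ltm w0.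
have n0 : (n <= 2 * n ^ 2)%N.
  by rewrite -mulnn mulnA leq_pmull // muln_gt0 (leq_ltn_trans _ (ltn_ord i)).
have hitp : has (hit p) L by apply: walk_hits w0; apply: leq_trans szp.
set d := find (hit p) L in ltm; have ltd : (d < size L)%N by rewrite -has_find.
have hitd : hit p (nth (0%N, [::]) L d) by apply: nth_find.
have outp : all (outside (take d L)) (i :: p).
  apply/allP=> y yp; apply/allP => kc.
  case/(nthP (0%N, [::])) => e; rewrite size_take ltd => lte.
  rewrite nth_take // => <-.
  by have /negbT/hasPn/(_ y yp) := before_find (0%N, [::]) lte.
have [fresh|] := boolP (all (outside (take d L)) (nth (0%N, [::]) L d).2).
  by exists p, d; split; split=> //; apply: mp_le_refl.
case/allPn => y yc yout.
case eqd: (nth (0%N, [::]) L d) hitd yc => [k c] /= hitd yc.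
have kcL : (k, c) \in L by rewrite -eqd mem_nth.
have el := indexed_elementary kcL.
have szc : (size c <= n)%N.
  case/and3P: el => _ /card_uniqP <- _.
  by rewrite -[n in (_ <= n)%N]card_ord max_card.
have [v vp vc] := hasP hitd.
have [||q [szq lastq subq wq]] :=
  splice_circuit (fun j p => @closed_walk_outside_le d k c j p ltd eqd) el
    (indexed_circuit_ge kcL) _ vp vc.
- by move: outp => /= /andP[].
- by apply: leq_trans szp; rewrite leq_mul2l -mulnn leq_mul2l szc orbT.
have hitq : (find (hit q) L < d)%N.
  case/allPn: yout => kc' kc'd; rewrite negbK => ykc'.
  have hitqd : has (hit q) (take d L).
    apply/hasP; exists kc' => //; apply/hasP; exists y => //.
    by rewrite inE subq ?orbT.
  rewrite -[X in find _ X](cat_take_drop d L) find_cat hitqd.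
  by move: hitqd; rewrite has_find size_takel // ltnW.
have wq0 : walk_weight A i q != 0.
  by apply: contraNneq w0 => w0; move: wq; rewrite /mp_le w0 addr0 => ->.
have [||//|q' [d' [[szq' lastq' wq' ltd'] P]]] := IH q.
- by rewrite szq.
- by apply: leq_trans hitq _.
exists q', d'; split=> //; split=> //; rewrite ?szq' ?lastq' //.
exact: mp_le_trans wq'.
Qed.

Lemma fresh_csr_ge d k c i p : (d < size L)%N -> nth (0%N, [::]) L d = (k, c) ->
  all (outside (take d L)) (i :: p) -> has (mem c) (i :: p) ->
  all (outside (take d L)) c ->
  walk_weight A i p <=mp (lambda k)%:mp ^+ size p *
   (csr_left A (outside (take d L)) (lambda k) c *m circuit_mx R c ^+ size p *m
    csr_right A (outside (take d L)) (lambda k) c) i (last i p).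
Proof.
move=> ltd nthd outp /hasP[v vp vc] outc.
have kcL : (k, c) \in L by rewrite -nthd mem_nth.
apply: csr_ge outp vp vc => //.
- exact: indexed_elementary kcL.
- exact: indexed_circuit_ge.
- by move=> j q; apply: closed_walk_outside_le ltd nthd.
Qed.

End MMCS.

(** * The expansion of the powers *)

Theorem corollary4p9 (R : realType) (n : nat) (A : 'M[rmax R]_n)
    (lam : seq R) (hlam : distinct_finite_roots A lam)
    (ccs : seq (multicircuit n)) (hccs : is_MMCS A lam ccs) :
  let P := node_partition ccs in
  let qc (s : 'I_(size P)) := block_circuit (tnth (in_tuple P) s) in
  let k (s : 'I_(size P)) := block_index (tnth (in_tuple P) s) in
  exists (C : forall s : 'I_(size P), 'M[rmax R]_(n, size (qc s)))
         (D : forall s : 'I_(size P), 'M[rmax R]_(size (qc s), n)),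
  forall t : nat, (2 * n ^ 2 <= t)%N ->
    A ^+ t =
    \sum_(s < size P)
      (fine (root_at lam (k s)))%:mp ^+ t
        *: (C s *m circuit_mx R (qc s) ^+ t *m D s).
Proof.
move=> P qc k; have [lam_sorted _] := hlam.
pose L := indexed_circuits ccs.
(* The walks of the term of block s avoid all circuits before the one that
   created the block. *)
pose V s := outside (take (index (k s, qc s) L) L).
have keyE (s : 'I_(size P)) :
    (k s, qc s) = nth (0%N, [::]) [seq block_key b | b <- P] s.
  have b0 := tnth (in_tuple P) s.
  by rewrite (nth_map b0) // /k /qc (tnth_nth b0).
have spec s : (k s, qc s) \in L /\ all (V s) (qc s).
  by apply: mem_node_partition_index; rewrite keyE mem_nth // size_map.
exists (fun s => csr_left A (V s) (fine (root_at lam (k s))) (qc s)).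
exists (fun s => csr_right A (V s) (fine (root_at lam (k s))) (qc s)).
move=> t let_; apply/matrixP => i j; rewrite summxE; apply: mp_le_antisym.
  rewrite -[X in X <=mp _]mul1r; apply: mul_expmx_le => p szp lastp; rewrite mul1r.
  have [->|w0] := eqVneq (walk_weight A i p) 0; first exact: mp_le0.
  rewrite -szp in let_.
  have [q [d [[szq lastq wq ltd] [outq hitq outc]]]] :=
    walk_to_fresh_circuit lam_sorted hccs let_ w0.
  have kcP : nth (0%N, [::]) L d \in [seq block_key b | b <- P].
    by apply/mem_node_partition; exists d.
  have [s' + eqs'] := nthP (0%N, [::]) kcP; rewrite size_map => lts'.
  pose s := Ordinal lts'.
  have eqks : nth (0%N, [::]) L d = (k s, qc s) by rewrite keyE.
  have [kcL Vs] := spec s.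
  have sub : subpred (outside (take d L)) (V s).
    apply: outside_take; rewrite leqNgt; apply/negP => /(before_find (0%N, [::])).
    by rewrite eqks /= eqxx.
  rewrite eqks in hitq.
  have lti : (index (k s, qc s) L < size L)%N by rewrite index_mem.
  have := fresh_csr_ge lam_sorted hccs lti (nth_index _ kcL) (sub_all sub outq) hitq Vs.
  rewrite szq lastq szp lastp => wq'.
  apply: mp_le_trans wq _; apply: mp_le_trans wq' _.
  set F := BIG_F.
  apply: mp_le_trans (@mp_le_sum _ _ predT F s isT).
  by rewrite /F [X in _ <=mp X]mxE; apply: mp_le_refl.
apply: mp_sum_le => s _; rewrite mxE; have [kcL Vs] := spec s.
have el := indexed_elementary lam_sorted hccs kcL.
apply: csr_le => //.
- exact: indexed_circuit_ge kcL.
have szc : (size (qc s) <= n)%N.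
  case/and3P: el => _ /card_uniqP <- _.
  by rewrite -[n in (_ <= n)%N]card_ord max_card.
by apply: leq_trans let_; rewrite leq_mul2l -mulnn leq_mul2l szc orbT.
Qed.
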